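(* Let $P\subset\mathbb{R}^D$ be an $(\epsilon_1,\epsilon_2)$-significant instance of $k$-means clustering with $z$ outliers, $|P|=n$, and let $\eta,\delta,\xi\in(0,1)$. Consider the following algorithm: (1) sample a set $S$ of $\max\{\frac{3k}{\delta^2\epsilon_1}\log\frac{2k}{\eta},\frac{k}{2\xi^2\epsilon_1(1-\delta)}\log\frac{2k}{\eta}\}$ points uniformly at random from $P$; (2) let $k'=\frac{1}{\eta}\frac{\epsilon_2}{k}|S|$ and solve $(k+k')$-means clustering on $S$ using any $c$-approximation algorithm with $c\ge1$; output the set $H$ of $k+k'$ returned centers. Then with probability at least $(1-\eta)^3$, $$\Delta^{-z}_2(P,H)\le\alpha\,\Delta^{-z}_2(P,O^* )+\beta\,\xi\,\mathcal{L}^2,$$ where $\alpha=2+(4+4c)\frac{1+\delta}{1-\delta}$ and $\beta=(4+4c)\frac{1+\delta}{1-\delta}$.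
   Context: For finite $H\subset\mathbb{R}^D$, $dist(p,H)=\min_{q\in H}\|p-q\|$; for integer $0<z<n$, $\Delta^{-z}_2(P,H)=\min\{\frac{1}{|P'|}\sum_{p\in P'}dist(p,H)^2: P'\subset P,|P'|=n-z\}$. The $k$-means clustering with $z$ outliers problem asks for $k$ centers in $\mathbb{R}^D$ minimizing $\Delta^{-z}_2(P,\cdot)$. $P_{opt}\subset P$, $|P_{opt}|=n-z$, is the set of inliers of an optimal solution, and $C^*_1,\dots,C^*_k$ are the optimal clusters forming $P_{opt}$; $o^*_j$ is the mean point of $C^*_j$ and $O^*=\{o^*_1,\dots,o^*_k\}$; $\mathcal{L}=\max_{1\le j\le k}\max_{p,q\in C^*_j}\|p-q\|$. The instance is $(\epsilon_1,\epsilon_2)$-significant ($\epsilon_1,\epsilon_2>0$) if $\min_j|C^*_j|\ge\frac{\epsilon_1}{k}n$ and $z=\frac{\epsilon_2}{k}n$. A $c$-approximation for $m$-means on $S$ returns $m$ centers $H$ with $\sum_{q\in S}dist(q,H)^2$ at most $c$ times the minimum over all sets of $m$ centers in $\mathbb{R}^D$. Sampling uniformly at random means each sample point is drawn independently and uniformly from $P$ ($S$ regarded as a multiset). *)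

(* Defs.v *)
From HB Require Import structures.
From mathcomp Require Import all_boot all_order all_algebra.
From mathcomp Require Import reals exp.
Set Implicit Arguments. Unset Strict Implicit. Unset Printing Implicit Defensive.
Import Order.TTheory GRing.Theory Num.Theory.
Local Open Scope ring_scope.

Section KMeans.
Variables (R : realType) (D : nat).
Notation pt := 'rV[R]_D.

Definition sqdist (p q : pt) : R := \sum_(i < D) (p ord0 i - q ord0 i) ^+ 2.
Definition edist (p q : pt) : R := Num.sqrt (sqdist p q).

(* dist(p,H)^2 = min_{q in H} ||p-q||^2 for a (nonempty) finite family of
   centers H : 'I_K -> pt.  The seed of the min is one of the centers, so for
   K > 0 this is exactly the minimum. *)
Definition dist2 (K : nat) (p : pt) (H : 'I_K -> pt) : R :=
  \big[Num.min/sqdist p (head 0 [seq H i | i <- enum 'I_K])]_(i < K) sqdist p (H i).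

Definition avg_cost (n K : nat) (P : 'I_n -> pt) (A : {set 'I_n}) (H : 'I_K -> pt) : R :=
  (\sum_(i in A) dist2 (P i) H) / #|A|%:R.

(* Delta_2^{-z}(P,H): minimum of avg_cost over all subsets of size n - z.
   The seed is the cost of the subset {0,..,n-z-1}, itself of size n - z. *)
Definition trimmed_cost (n K : nat) (P : 'I_n -> pt) (z : nat) (H : 'I_K -> pt) : R :=
  \big[Num.min/avg_cost P [set i : 'I_n | (i < n - z)%N] H]_(A : {set 'I_n} | #|A| == (n - z)%N)
     avg_cost P A H.

Definition cluster (n k : nat) (Popt : {set 'I_n}) (a : 'I_n -> 'I_k) (j : 'I_k) : {set 'I_n} :=
  [set i in Popt | a i == j].

Definition mean_pt (n : nat) (P : 'I_n -> pt) (C : {set 'I_n}) : pt :=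
  (#|C|%:R)^-1 *: \sum_(i in C) P i.

Definition diamL (n k : nat) (P : 'I_n -> pt) (C : 'I_k -> {set 'I_n}) : R :=
  \big[Num.max/0]_(j < k) \big[Num.max/0]_(i in C j) \big[Num.max/0]_(i' in C j)
     edist (P i) (P i').

(* (O0, Popt, a) is an optimal solution of k-means with z outliers on P:
   O0 minimizes Delta^{-z}_2(P, .) among all k-center sets, Popt (|Popt| = n-z)
   is its inlier set realizing the minimum, and a assigns each inlier to a
   nearest center of O0 (so the clusters C*_j partition Popt). *)
Definition optimal_solution (n k z : nat) (P : 'I_n -> pt) (O0 : 'I_k -> pt)
    (Popt : {set 'I_n}) (a : 'I_n -> 'I_k) : Prop :=
  [/\ forall H : 'I_k -> pt, trimmed_cost P z O0 <= trimmed_cost P z H,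
      #|Popt| = (n - z)%N,
      avg_cost P Popt O0 = trimmed_cost P z O0 &
      forall i, i \in Popt -> sqdist (P i) (O0 (a i)) = dist2 (P i) O0].

Definition significant (n k z : nat) (C : 'I_k -> {set 'I_n}) (eps1 eps2 : R) : Prop :=
  [/\ 0 < eps1, 0 < eps2,
      forall j, eps1 / k%:R * n%:R <= #|C j|%:R &
      z%:R = eps2 / k%:R * n%:R].

End KMeans.

(* Main.v *)
Require Import Defs.
From HB Require Import structures.
From mathcomp Require Import all_boot all_order all_algebra.
From mathcomp Require Import reals sequences exp.
From mathcomp Require Import ring lra zify.
Import Order.TTheory GRing.Theory Num.Theory.
Local Open Scope ring_scope.

(** The bound holds for every sample avoiding three failures: some cluster gets
    fewer than [(1 - delta)] times its expected number of samples; the sampled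
    inliers are too far from their cluster means in total; or more than [kp]
    outliers are drawn.  Otherwise, every inlier reaches the output centers
    through the mean of its cluster and the samples of that cluster, and the
    means together with the sampled outliers are [k + kp] admissible centers.

    The first two failures have exponentially small probability (Chernoff); for
    the second, the two lower bounds on the sample size combine through their
    geometric mean.  A union bound with Markov's inequality for the outliers only
    gives [1 - O(eta)], which is below [(1 - eta)^3] for [eta] close to [1].
    There one uses that the median of a binomial law is at most the ceiling of
    its mean, so that too many outliers are drawn with probability at most
    [1/2]. *)

(** * Binomial tails *)

Section BinomialTail.
Context {R : realType}.

(** Binomial weight for success odds [z : w], left unnormalised (the total is [(z + w) ^ m]), so
    that [z] and [w] can be the sizes of a set and its complement. *)
Definition binom_term (m z w j : nat) : R :=
  'C(m, j)%:R * z%:R ^+ j * w%:R ^+ (m - j).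

Lemma binom_term_ge0 m z w j : 0 <= binom_term m z w j.
Proof. by rewrite /binom_term !mulr_ge0 ?exprn_ge0. Qed.

Lemma binom_term_small m z w j : (m < j)%N -> binom_term m z w j = 0.
Proof. by move=> mj; rewrite /binom_term bin_small// !mul0r. Qed.

Lemma sum_binom_term m z w :
  \sum_(j < m.+1) binom_term m z w j = (z + w)%:R ^+ m.
Proof.
rewrite natrD addrC exprDn; apply: eq_bigr => j _.
by rewrite /binom_term -[RHS]mulr_natl; ring.
Qed.

Lemma sum_binom_term_mean m z w :
  \sum_(j < m.+1) j%:R * binom_term m z w j * (z + w)%:R =
  m%:R * z%:R * (z + w)%:R ^+ m.
Proof.
case: m => [|m]; first by rewrite big_ord_recl big_ord0 !mul0r addr0.
rewrite -mulr_suml big_ord_recl mul0r add0r exprSr mulrA; congr (_ * _).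
rewrite -sum_binom_term mulr_sumr; apply: eq_bigr => j _.
rewrite /binom_term /= /bump leq0n add1n subSS !mulrA -natrM -mul_bin_diag /=.
by rewrite natrM exprS; ring.
Qed.

Lemma binom_term_rec m z w j : (j < m)%N ->
  binom_term m z w j.+1 * j.+1%:R * w%:R =
  binom_term m z w j * (m - j)%:R * z%:R.
Proof.
move=> jm; rewrite /binom_term.
have -> : w%:R ^+ (m - j) = w%:R ^+ (m - j.+1) * w%:R :> R.
  by rewrite -exprSr -subSn.
have -> : 'C(m, j)%:R * z%:R ^+ j * (w%:R ^+ (m - j.+1) * w%:R) * (m - j)%:R * z%:R
  = ((m - j) * 'C(m, j))%:R * z%:R ^+ j.+1 * w%:R ^+ (m - j.+1) * w%:R :> R.
  by rewrite natrM exprS; ring.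
by rewrite -mul_bin_left natrM; ring.
Qed.

(** Let [i0] be the first index where [d] is positive. Replacing every weight [2 i + 1] by
    [2 i0 + 1] can only lower the sum: weights grow where [d <= 0] and shrink where [d >= 0]. *)
Lemma single_crossing_sum_le0 (d : nat -> R) (K : nat) :
  (forall i i', (i < i')%N -> 0 < d i -> 0 <= d i') ->
  \sum_(i < K) (2 * i + 1)%:R * d i <= 0 -> \sum_(i < K) d i <= 0.
Proof.
move=> dcross dsum.
have [/existsP expos|/existsPn nopos] := boolP [exists i : 'I_K, 0 < d i]; last first.
  by apply: sumr_le0 => i _; rewrite leNgt nopos.
have ex : exists i, 0 < d i by case: expos => i di; exists i.
case: (ex_minnP ex) => i0 di0 i0min.
rewrite -(pmulr_rle0 _ (_ : 0 < (2 * i0 + 1)%:R)) ?ltr0n ?addn1//.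
apply: le_trans dsum; rewrite mulr_sumr; apply: ler_sum => i _.
rewrite -subr_ge0 -mulrBl.
have [lti|gti|ieq] := ltngtP i i0; last by rewrite ieq addn1 subrr mul0r.
- apply: mulr_le0; first by rewrite subr_le0 ler_nat; lia.
  by rewrite leNgt; apply/negP => /i0min; lia.
- apply: mulr_ge0; first by rewrite subr_ge0 ler_nat; lia.
  exact: (dcross i0).
Qed.

(* The terms above [a] and their mirror images about [a + 1/2] cross at most
   once: with [b = m - a], the ratio of the [s]-th pair increases from [s - 1] to
   [s] iff [(b^2 - s^2) z^2 > ((a+1)^2 - s^2) w^2], which fails at [s = 0] and
   persists once it holds. *)
Lemma binom_term_crossing m z w a i i' : (a < m)%N -> (0 < z)%N -> (0 < w)%N ->
  (m * z <= a * (z + w))%N -> (i < i')%N -> (i' <= a)%N ->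
  binom_term m z w (a - i) < binom_term m z w (a.+1 + i) ->
  binom_term m z w (a - i') <= binom_term m z w (a.+1 + i').
Proof.
move=> am z0 w0 mean ii' i'a.
set f := binom_term m z w.
have [b mE] : exists b, m = (a + b)%N by exists (m - a)%N; lia.
have bz : b%:R * z%:R <= a%:R * w%:R :> R by rewrite -!natrM ler_nat; nia.
have z0R : 0 < z%:R :> R by rewrite ltr0n.
have w0R : 0 < w%:R :> R by rewrite ltr0n.
have f0 j : 0 <= f j by exact: binom_term_ge0.
pose E (s : nat) : R := (b%:R ^+ 2 - s%:R ^+ 2) * z%:R ^+ 2
                        - ((a%:R + 1) ^+ 2 - s%:R ^+ 2) * w%:R ^+ 2.
have bza : (b%:R * z%:R) ^+ 2 < ((a%:R + 1) * w%:R) ^+ 2 :> R.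
  rewrite ltr_pXn2r// ?nnegrE ?mulr_ge0 ?addr_ge0 ?ler0n//.
  by apply: le_lt_trans bz _; rewrite mulrDl mul1r ltrDl.
(* [E] is affine in [s^2] with slope [w^2 - z^2], and [bza] says [E 0 < 0]; a positive value thus
   forces a positive slope. *)
have EM s t : (s <= t)%N -> 0 < E s -> 0 < E t.
  move=> st; rewrite /E => Es.
  have s2t : s%:R ^+ 2 <= t%:R ^+ 2 :> R by rewrite ler_pXn2r// ?nnegrE ?ler0n// ler_nat.
  have s2 : 0 <= s%:R ^+ 2 :> R by rewrite exprn_ge0 ?ler0n.
  have zw : 0 < w%:R ^+ 2 - z%:R ^+ 2 :> R.
    rewrite ltNge; apply/negP => zw.
    have : s%:R ^+ 2 * (w%:R ^+ 2 - z%:R ^+ 2) <= 0 :> R by rewrite mulr_ge0_le0.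
    by rewrite !exprMn in bza; lra.
  have : 0 <= (t%:R ^+ 2 - s%:R ^+ 2) * (w%:R ^+ 2 - z%:R ^+ 2) :> R.
    by rewrite mulr_ge0 ?subr_ge0// ltW// -subr_gt0.
  by lra.
have GS s : (0 < s <= a)%N -> f (a - s)%N * (b%:R + s%:R) * z%:R =
    f (a - s.-1)%N * (a%:R + 1 - s%:R) * w%:R.
  move=> sa; have := @binom_term_rec m z w (a - s)%N.
  have -> : (a - s).+1 = (a - s.-1)%N by lia.
  have -> : (m - (a - s) = b + s)%N by lia.
  have -> : a%:R + 1 - s%:R = (a - s.-1)%:R :> R.
    have -> : (a - s.-1 = a.+1 - s)%N by lia.
    by rewrite natrB ?natr1//; lia.
  by rewrite natrD => ->//; lia.
have FS s : (0 < s <= b)%N -> f (a.+1 + s)%N * (a%:R + 1 + s%:R) * w%:R =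
    f (a.+1 + s.-1)%N * (b%:R - s%:R) * z%:R.
  move=> sb; have -> : (a.+1 + s.-1 = a + s)%N by lia.
  have -> : a%:R + 1 + s%:R = (a + s).+1%:R :> R by rewrite -natr1 natrD; ring.
  (* At [s = b] the left term has index [m + 1], so both sides vanish. *)
  rewrite addSn; have [sltb|] := ltnP s b; last first.
    move=> bs; have -> : s = b by lia.
    by rewrite /f binom_term_small ?mE// subrr mulr0 !mul0r.
  rewrite /f binom_term_rec; last by lia.
  have -> : (m - (a + s) = b - s)%N by lia.
  by rewrite natrB//; lia.
pose X s := f (a - s)%N < f (a.+1 + s)%N.
(* A common multiplier for both recurrences: the two resulting factors, in [GK] and [FK], differ
   exactly by [E s]. *)
pose K s : R := (a%:R + 1 + s%:R) * (b%:R + s%:R) * w%:R * z%:R.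
have K0 s : (0 < s)%N -> 0 < K s.
  by move=> s0; rewrite /K natr1 -!natrD !mulr_gt0// ltr0n; lia.
have GK s : (0 < s <= a)%N ->
    f (a - s)%N * K s = f (a - s.-1)%N * (((a%:R + 1) ^+ 2 - s%:R ^+ 2) * w%:R ^+ 2).
  move=> /GS GSs; rewrite /K.
  have -> : f (a - s)%N * ((a%:R + 1 + s%:R) * (b%:R + s%:R) * w%:R * z%:R)
    = (f (a - s)%N * (b%:R + s%:R) * z%:R) * ((a%:R + 1 + s%:R) * w%:R) by ring.
  by rewrite GSs; ring.
have FK s : (0 < s <= b)%N ->
    f (a.+1 + s)%N * K s = f (a.+1 + s.-1)%N * ((b%:R ^+ 2 - s%:R ^+ 2) * z%:R ^+ 2).
  move=> /FS FSs; rewrite /K.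
  have -> : f (a.+1 + s)%N * ((a%:R + 1 + s%:R) * (b%:R + s%:R) * w%:R * z%:R)
    = (f (a.+1 + s)%N * (a%:R + 1 + s%:R) * w%:R) * ((b%:R + s%:R) * z%:R) by ring.
  by rewrite FSs; ring.
have sa2 s : (s <= a)%N -> 0 < ((a%:R + 1) ^+ 2 - s%:R ^+ 2) * w%:R ^+ 2 :> R.
  move=> sa; rewrite natr1 mulr_gt0 ?exprn_gt0// subr_gt0.
  by rewrite ltr_pXn2r ?nnegrE ?ler0n// ltr_nat.
have XSE s : (0 < s <= a)%N -> ~~ X s.-1 -> X s -> 0 < E s.
  rewrite /X -leNgt => sa XP Xs.
  have sb : (0 < s <= b)%N.
    rewrite (andP sa).1 /= leqNgt; apply/negP => bs.
    by move: Xs; rewrite [f (a.+1 + s)%N]binom_term_small ?ltNge ?f0//; lia.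
  have s0 : (0 < s)%N by lia.
  move: Xs; rewrite -(ltr_pM2r (K0 _ s0)) GK// FK// => Xs.
  have sb2 : 0 <= (b%:R ^+ 2 - s%:R ^+ 2) * z%:R ^+ 2 :> R.
    rewrite mulr_ge0 ?exprn_ge0// subr_ge0 ler_pXn2r ?nnegrE ?ler0n// ler_nat; lia.
  have := lt_le_trans Xs (ler_wpM2r sb2 XP).
  have := f0 (a - s.-1)%N; rewrite le_eqVlt => /predU1P[<-|G0]; first by rewrite !mul0r ltxx.
  by rewrite ltr_pM2l// /E subr_gt0.
have EXS s : (0 < s <= a)%N -> 0 < E s -> X s.-1 -> X s.
  rewrite /X /E subr_gt0 => sa Es Xp.
  have /andP[s0 sa'] := sa.
  have sb : (0 < s <= b)%N.
    rewrite s0 /= leqNgt; apply/negP => bs.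
    have := lt_trans (sa2 _ sa') Es; rewrite pmulr_lgt0 ?exprn_gt0//.
    by rewrite subr_gt0 ltr_pXn2r ?nnegrE ?ler0n// ltr_nat; lia.
  rewrite -(ltr_pM2r (K0 _ s0)) GK// FK//.
  apply: le_lt_trans (ler_wpM2l (f0 _) (ltW Es)) _.
  by rewrite ltr_pM2r// (lt_trans (sa2 _ sa') Es).
have X0 : ~~ X 0%N.
  rewrite /X -leNgt subn0 addn0.
  have := @binom_term_rec m z w a am.
  have -> : (m - a = b)%N by lia.
  move=> rec; rewrite -(ler_pM2r (_ : 0 < a.+1%:R * w%:R :> R)) ?mulr_gt0 ?ltr0n//.
  rewrite /f mulrA rec -mulrA ler_wpM2l// (le_trans bz)// ler_wpM2r ?ler0n//.
  by rewrite ler_nat.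
have XE t : (t <= a)%N -> X t -> exists2 s, (0 < s <= t)%N & 0 < E s.
  elim: t => [_ Xt|t IH ta Xt]; first by rewrite Xt in X0.
  have [Xt'|nXt] := boolP (X t).
    by have [s st Es] := IH (ltnW ta) Xt'; exists s => //; lia.
  by exists t.+1; [lia|apply: XSE => //; lia].
(* Since [X] fails at 0, [X i] needs some earlier [E s > 0]; then [E] stays positive and [X]
   propagates from [i] up to [i']. *)
move=> Xi; have [|s si Es] := XE i _ Xi; first by lia.
have XD t : (i + t <= a)%N -> X (i + t)%N.
  elim: t => [|t IH] it; first by rewrite addn0.
  rewrite addnS; apply: EXS; [lia| |by apply: IH; lia].
  by apply: EM Es; lia.
by rewrite ltW// -(subnKC (ltnW ii')); apply: XD; lia.
Qed.

(** Reindexing by [j = a + 1 + i] above [a] and [j = a - i] below. For [g i = 2 i + 1] both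
    coefficients on the right equal [2 j - (2 a + 1)]; for [g = 1] they are signs. *)
Lemma sum_mirror (f g : nat -> R) (m a : nat) : (a < m)%N ->
  (forall j, (m < j)%N -> f j = 0) ->
  \sum_(i < m.+1) g i * (f (a.+1 + i)%N - (if (i <= a)%N then f (a - i)%N else 0)) =
  \sum_(j < m.+1) (if (a < j)%N then g (j - a.+1)%N else - g (a - j)%N) * f j.
Proof.
move=> am f0.
transitivity (\sum_(0 <= i < m.+1) g i * f (a.+1 + i)%N
    - \sum_(0 <= i < a.+1) g i * f (a - i)%N).
  rewrite !big_mkord (big_ord_widen _ (fun i => g i * f (a - i)%N) (leqW am)).
  rewrite [X in _ - X]big_mkcond /= -sumrB; apply: eq_bigr => i _.
  by rewrite ltnS; case: ifP => _; rewrite mulrBr ?mulr0.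
rewrite -[RHS](big_mkord xpredT (fun j =>
  (if (a < j)%N then g (j - a.+1)%N else - g (a - j)%N) * f j)).
rewrite [RHS](big_cat_nat (n := a.+1))//=; last by lia.
rewrite [RHS]addrC; congr (_ + _); last first.
  rewrite -sumrN [LHS]big_nat_rev /=; apply: eq_big_nat => j ja.
  have -> : (0 + a.+1 - j.+1 = a - j)%N by lia.
  have -> : (a - (a - j) = j)%N by lia.
  by rewrite ifF ?mulNr//; lia.
rewrite (big_cat_nat (n := (m - a)%N))//=; last by lia.
rewrite [X in _ + X]big_nat_cond [X in _ + X]big1 ?addr0; last first.
  by move=> i /andP[? _]; rewrite f0 ?mulr0//; lia.
have shift (F : nat -> R) : \sum_(a.+1 <= j < m.+1) F j = \sum_(0 <= i < m - a) F (i + a.+1)%N.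
  by rewrite -{1}[a.+1]add0n big_addn subSS.
rewrite shift; apply: eq_big_nat => i _.
have -> : (a < i + a.+1)%N by lia.
by rewrite addnK addnC.
Qed.

(** Weighted by [2 i + 1], the mirrored differences add up to the total mass times
    [2 mean - (2 a + 1)], which is negative. Single crossing removes the weights, so the part above
    [a] is at most the part up to [a]. *)
Lemma binom_median m z w a : (0 < z)%N -> (0 < w)%N -> (m * z <= a * (z + w))%N ->
  2 * \sum_(j < m.+1 | (a < j)%N) binom_term m z w j <= (z + w)%:R ^+ m.
Proof.
move=> z0 w0 mean; have [ma|am] := leqP m a.
  rewrite big1 ?mulr0 ?exprn_ge0// => j aj.
  by have := ltn_ord j; lia.
pose f := binom_term m z w.
have fsmall j : (m < j)%N -> f j = 0 by exact: binom_term_small.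
pose d i := f (a.+1 + i)%N - (if (i <= a)%N then f (a - i)%N else 0).
have : \sum_(i < m.+1) d i <= 0.
  apply: single_crossing_sum_le0.
    (* Beyond [a] there is no mirror image left, and the difference is a single nonnegative term. *)
    move=> i i' ii'; rewrite /d; case: (leqP i' a) => [i'a|_ _]; last first.
      by rewrite subr0 binom_term_ge0.
    rewrite ifT ?subr_gt0 ?subr_ge0; last by lia.
    exact: binom_term_crossing.
  rewrite (sum_mirror _ (fun i => (2 * i + 1)%:R))//.
  rewrite (eq_bigr (fun j : 'I_m.+1 => 2 * (j%:R * f j) - (2 * a + 1)%:R * f j)); last first.
    have oddE i : (2 * i + 1)%:R = 2 * i%:R + 1 :> R by rewrite natrD natrM.
    move=> j _; rewrite !oddE; case: ifP => aj; first by rewrite natrB// -natr1; ring.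
    by rewrite natrB; [ring|lia].
  rewrite sumrB -!mulr_sumr sum_binom_term subr_le0.
  have zw0 : 0 < (z + w)%:R :> R by rewrite ltr0n; lia.
  rewrite -(ler_pM2r zw0) -mulrA mulr_suml sum_binom_term_mean.
  rewrite [leLHS](_ : _ = (2 * (m * z))%:R * (z + w)%:R ^+ m); last by ring.
  rewrite [leRHS](_ : _ = ((2 * a + 1) * (z + w))%:R * (z + w)%:R ^+ m); last by ring.
  by rewrite ler_wpM2r ?exprn_ge0 ?ler0n// ler_nat; nia.
rewrite (eq_bigr (fun i : 'I__ => 1 * d i)) => [|i _]; last by rewrite mul1r.
rewrite (sum_mirror _ (fun=> 1))// -sum_binom_term (bigID (fun j : 'I__ => (a < j)%N)) /=.
rewrite [X in _ -> _ <= X](bigID (fun j : 'I__ => (a < j)%N)) /=.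
rewrite (eq_bigr (fun j : 'I__ => f j)) => [|j ->]; last by rewrite mul1r.
rewrite [X in _ + X <= 0](eq_bigr (fun j : 'I__ => - f j)) => [|j /negPf ->]; last by rewrite mulN1r.
by rewrite sumrN /f; lra.
Qed.

Lemma binom_markov m z w a : (0 < z + w)%N ->
  \sum_(j < m.+1 | (a < j)%N) binom_term m z w j * (a.+1%:R * (z + w)%:R) <=
  m%:R * z%:R * (z + w)%:R ^+ m.
Proof.
move=> zw0; rewrite -sum_binom_term_mean [leRHS](bigID (fun j : 'I__ => (a < j)%N)) /=.
apply: ler_wpDr.
  by apply: sumr_ge0 => j _; rewrite mulr_ge0 ?ler0n// mulr_ge0 ?ler0n// binom_term_ge0.
apply: ler_sum => j aj; rewrite mulrA ler_wpM2r ?ler0n// mulrC.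
by rewrite ler_wpM2r ?binom_term_ge0// ler_nat.
Qed.

End BinomialTail.

(** * Uniform samples with replacement *)

Section UniformSample.
Context {R : realType} {m n : nat}.
Implicit Types (E F : {set {ffun 'I_m -> 'I_n}}) (A : {set 'I_n}).

Definition prob E : R := #|E|%:R / (n ^ m)%:R.

Definition hits A (s : {ffun 'I_m -> 'I_n}) : nat := #|[set i | s i \in A]|.

Lemma prob_le E F : E \subset F -> prob E <= prob F.
Proof. by move=> EF; rewrite ler_wpM2r ?invr_ge0 ?ler0n// ler_nat subset_leq_card. Qed.

Lemma probU E F : prob (E :|: F) <= prob E + prob F.
Proof.
rewrite -mulrDl ler_wpM2r ?invr_ge0 ?ler0n// -natrD ler_nat.
exact: leq_card_setU.
Qed.

Lemma prob_bigcup k (F : 'I_k -> {set {ffun 'I_m -> 'I_n}}) :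
  prob (\bigcup_j F j) <= \sum_j prob (F j).
Proof.
elim/big_ind2: _ => // [|E p E' p' Ep E'p'].
  by rewrite /prob cards0 mul0r.
by apply: le_trans (probU _ _) _; rewrite lerD.
Qed.

Lemma probC E : (0 < n)%N -> prob (~: E) = 1 - prob E.
Proof.
move=> n0; have := cardsC E; rewrite card_ffun !card_ord => cE.
have nm0 : (n ^ m)%:R != 0 :> R by rewrite pnatr_eq0 -lt0n expn_gt0 n0.
apply: (mulIf nm0); rewrite mulrBl mul1r !divfK//.
by rewrite -{}cE natrD addrAC subrr add0r.
Qed.

Lemma sum_prod_sample (g : 'I_n -> R) :
  \sum_(s : {ffun 'I_m -> 'I_n}) \prod_i g (s i) = (\sum_x g x) ^+ m.
Proof. by rewrite -(bigA_distr_bigA (fun=> g)) prodr_const card_ord. Qed.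

(** Markov's inequality for the exponential of the sum, which factors over the independent draws.
    The usual free parameter is absorbed into [Y]. *)
Lemma chernoff_tail (Y : 'I_n -> R) (b t : R) : (0 < n)%N ->
  \sum_x expR (Y x) <= n%:R * expR b ->
  prob [set s : {ffun 'I_m -> 'I_n} | t <= \sum_i Y (s i)] <= expR (m%:R * b - t).
Proof.
move=> n0 mgf; rewrite /prob ler_pdivrMr ?ltr0n ?expn_gt0 ?n0//.
rewrite expRB mulrAC ler_pdivlMr ?expR_gt0//.
apply: (@le_trans _ _ ((\sum_x expR (Y x)) ^+ m)); last first.
  apply: le_trans (_ : _ <= (n%:R * expR b) ^+ m) _.
    by rewrite lerXn2r ?nnegrE// ?mulr_ge0 ?expR_ge0 ?ler0n// sumr_ge0// => x _; exact: expR_ge0.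
  by rewrite exprMn -expRM_natl natrX mulrC.
rewrite -sum_prod_sample (bigID (mem [set s : {ffun 'I_m -> 'I_n} | t <= \sum_i Y (s i)])) /= ler_wpDr//.
  by apply: sumr_ge0 => s _; rewrite prodr_ge0// => i _; exact: expR_ge0.
rewrite -sum1_card natr_sum mulr_suml; apply: ler_sum => s.
by rewrite inE mul1r => ts; rewrite -expR_sum ler_expR.
Qed.

Lemma card_preim_sample A (T : {set 'I_m}) :
  #|[set s : {ffun 'I_m -> 'I_n} | [set i | s i \in A] == T]| =
  (#|A| ^ #|T| * #|~: A| ^ (m - #|T|))%N.
Proof.
transitivity #|family (fun (i : 'I_m) (x : 'I_n) => (x \in A) == (i \in T))|.
  apply: eq_card => s; rewrite inE; apply/eqP/familyP => [<- i|sT].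
    by apply/eqP; rewrite inE.
  by apply/setP => i; rewrite inE; have /eqP := sT i.
rewrite card_family /image_mem foldrE big_map big_enum /= (bigID (mem T)) /=; congr (_ * _)%N.
  rewrite (eq_bigr (fun=> #|A|)) ?prod_nat_const// => i iT.
  by apply: eq_card => x; rewrite -topredE /= iT eqb_id.
rewrite (eq_bigr (fun=> #|~: A|)) => [|i iT]; last first.
  by apply: eq_card => x; rewrite inE -topredE /= (negPf iT) eqbF_neg.
rewrite prod_nat_const; congr (_ ^ _)%N.
transitivity #|~: T|; first by apply: eq_card => i; rewrite inE.
by apply/eqP; rewrite -(eqn_add2l #|T|) cardsC card_ord subnKC// -[leqRHS]card_ord max_card.
Qed.

(** The number of hits is binomial: samples are grouped by the set of positions that hit [A], and
    these sets by cardinality. *)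
Lemma sum_hits A (g : nat -> R) :
  \sum_(s : {ffun 'I_m -> 'I_n}) g (hits A s) =
  \sum_(j < m.+1) g j * binom_term m #|A| #|~: A| j.
Proof.
rewrite (partition_big (fun s : {ffun 'I_m -> 'I_n} => [set i | s i \in A]) predT)//=.
transitivity (\sum_(T : {set 'I_m}) g #|T| * (#|A| ^ #|T| * #|~: A| ^ (m - #|T|))%:R).
  apply: eq_bigr => T _; rewrite -card_preim_sample.
  rewrite (eq_bigr (fun=> g #|T|)) => [|s /eqP <-//].
  by rewrite sumr_const mulr_natr; congr (_ *+ _); apply: eq_card => s; rewrite !inE.
have cT (T : {set 'I_m}) : (#|T| < m.+1)%N.
  by have := max_card (mem T); rewrite card_ord ltnS.
rewrite (partition_big (fun T : {set 'I_m} => Ordinal (cT T)) predT)//=.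
apply: eq_bigr => j _.
rewrite (eq_bigr (fun=> g j * (#|A| ^ j * #|~: A| ^ (m - j))%:R)); last first.
  by move=> T /eqP <-.
rewrite (eq_bigl (fun T => T \in [set T : {set 'I_m} | #|T| == j])) => [|T]; last by rewrite inE.
by rewrite sumr_const card_draws card_ord -[LHS]mulr_natr /binom_term natrM !natrX; ring.
Qed.

Lemma prob_hits_gt A a : prob [set s | (a < hits A s)%N] =
  (\sum_(j < m.+1 | (a < j)%N) binom_term m #|A| #|~: A| j) / (n ^ m)%:R.
Proof.
congr (_ / _); rewrite -sum1_card natr_sum big_mkcond /=.
transitivity (\sum_(s : {ffun 'I_m -> 'I_n}) (a < hits A s)%N%:R : R).
  by apply: eq_bigr => s _; rewrite inE; case: ifP.
rewrite (sum_hits A (fun j => (a < j)%N%:R)) [RHS]big_mkcond /=; apply: eq_bigr => j _.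
by case: ifP; rewrite ?mul1r ?mul0r.
Qed.

Lemma prob_hits_markov A a (eta : R) : (0 < n)%N -> 0 <= eta ->
  m%:R * #|A|%:R <= eta * a%:R * n%:R ->
  prob [set s | (a < hits A s)%N] <= eta.
Proof.
move=> n0 eta0 mean; have nE : (#|A| + #|~: A| = n)%N by rewrite cardsC card_ord.
have := @binom_markov R m #|A| #|~: A| a; rewrite nE => /(_ n0).
rewrite prob_hits_gt ler_pdivrMr ?ltr0n ?expn_gt0 ?n0// -mulr_suml natrX.
set t := \sum_(_ < _ | _) _ => tail.
have n0R : 0 < n%:R :> R by rewrite ltr0n.
have a0 : 0 < a.+1%:R :> R by rewrite ltr0n.
have t0 : 0 <= t by apply: sumr_ge0 => j _; exact: binom_term_ge0.
rewrite -(ler_pM2r (mulr_gt0 a0 n0R)); apply: le_trans tail _.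
rewrite [leRHS](_ : _ = eta * a.+1%:R * n%:R * n%:R ^+ m); last by ring.
rewrite ler_wpM2r ?exprn_ge0 ?ler0n// (le_trans mean)//.
by rewrite ler_wpM2r ?ler0n// ler_wpM2l// ler_nat.
Qed.

Lemma prob_hits_median A a : (0 < #|A|)%N -> (0 < #|~: A|)%N ->
  (m * #|A| <= a * n)%N -> prob [set s | (a < hits A s)%N] <= 1 / 2.
Proof.
move=> A0 AC0; have nE : (#|A| + #|~: A| = n)%N by rewrite cardsC card_ord.
have n0 : (0 < n)%N by rewrite -nE addn_gt0 A0.
have := @binom_median R m #|A| #|~: A| a A0 AC0; rewrite nE => /[apply].
rewrite prob_hits_gt ler_pdivrMr ?ltr0n ?expn_gt0 ?n0// natrX.
by lra.
Qed.

End UniformSample.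

(** * Exponential inequalities and Chernoff bounds *)

Lemma expR_ge_quadratic {R : realType} (x : R) : 0 <= x -> 1 + x + x ^+ 2 / 2 <= expR x.
Proof.
move=> x0; have := nondecreasing_cvgn_le _ (is_cvg_series_exp_coeff x) 3.
rewrite /series /= !big_nat_recr//= big_geq// /exp_coeff /=.
rewrite expr0 expr1 !fact0 factS fact0 muln1 !divr1 add0r.
apply; apply: nondecreasing_series => i _ _.
exact: exp_coeff_ge0.
Qed.

(** Follows from the previous bound, as [(1 - x + x^2/2) (1 + x + x^2/2) = 1 + x^4/4]. *)
Lemma expRN_le_quadratic {R : realType} (x : R) : 0 <= x -> expR (- x) <= 1 - x + x ^+ 2 / 2.
Proof.
move=> x0; rewrite expRN -div1r ler_pdivrMr ?expR_gt0//.
have pos : 0 <= 1 - x + x ^+ 2 / 2 by nra.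
apply: le_trans (ler_wpM2l pos (expR_ge_quadratic x x0)).
have : 0 <= (x ^+ 2) ^+ 2 by rewrite sqr_ge0.
by lra.
Qed.

(* The tangent inequality [1 + t <= expR t] at [l * (1 - y)] and at [- (l * y)],
   averaged with weights [y] and [1 - y]. *)
Lemma expR_chord {R : realType} (l y : R) : 0 <= y <= 1 ->
  expR (l * y) <= 1 + (expR l - 1) * y.
Proof.
move=> /andP[y0 y1].
have e0 := expR_gt0 (l * y).
have h1 : expR (l * y) * (1 + l * (1 - y)) <= expR l.
  rewrite [leRHS](_ : _ = expR (l * y) * expR (l * (1 - y))).
    by rewrite ler_pM2l// expR_ge1Dx.
  by rewrite -expRD; congr expR; ring.
have h2 : expR (l * y) * (1 - l * y) <= 1.
  by rewrite -[leRHS](expRxMexpNx_1 (l * y)) ler_pM2l// expR_ge1Dx.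
have := ler_wpM2r y0 h1; have /(ler_wpM2r) := h2.
by move=> /(_ (1 - y)); rewrite subr_ge0 => /(_ y1); lra.
Qed.

Section SampleTails.
Context {R : realType} {m n : nat}.
Hypothesis n_gt0 : (0 < n)%N.

(** The Chernoff parameter is [- delta], not the optimal [ln (1 - delta)]: the quadratic bound on
    [expR (- delta)] already yields [delta^2 / 2]. *)
Lemma prob_hits_lower (A : {set 'I_n}) (delta : R) : 0 <= delta ->
  prob [set s : {ffun 'I_m -> 'I_n} |
         (hits A s)%:R < (1 - delta) * (m%:R * #|A|%:R / n%:R)] <=
  expR (- (delta ^+ 2 / 2 * (m%:R * #|A|%:R / n%:R))).
Proof.
move=> d0; rewrite -[m%:R * _ / _]mulrA; set p : R := #|A|%:R / n%:R.
have n0 : 0 < n%:R :> R by rewrite ltr0n.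
have p0 : 0 <= p by rewrite divr_ge0 ?ler0n.
pose Y (x : 'I_n) : R := if x \in A then - delta else 0.
have YE (s : {ffun 'I_m -> 'I_n}) : \sum_i Y (s i) = - delta * (hits A s)%:R.
  rewrite /Y -big_mkcond /= sumr_const /hits -[LHS]mulr_natr; congr (_ * _%:R).
  by apply: eq_card => i; rewrite inE.
apply: le_trans (_ : _ <= prob [set s : {ffun 'I_m -> 'I_n} |
    - delta * ((1 - delta) * (m%:R * p)) <= \sum_i Y (s i)]) _.
  apply: prob_le; apply/subsetP => s; rewrite !inE YE => hs.
  by rewrite !mulNr lerN2 ler_wpM2l// ltW.
apply: le_trans (chernoff_tail Y (- p * (delta - delta ^+ 2 / 2)) _ n_gt0 _) _; last first.
  by rewrite ler_expR; lra.
rewrite (eq_bigr (fun x => 1 + (if x \in A then expR (- delta) - 1 else 0))) => [|x _]; last first.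
  by rewrite /Y; case: ifP => _; rewrite ?expR0 ?addr0// addrC subrK.
rewrite big_split /= sumr_const card_ord -big_mkcond /= sumr_const -[_ *+ #|A|]mulr_natr.
have -> : #|A|%:R = n%:R * p :> R by rewrite /p mulrCA divff ?mulr1// gt_eqF.
apply: le_trans (ler_wpM2l (ltW n0) (expR_ge1Dx _)).
have := expRN_le_quadratic delta d0 => /(ler_wpM2l (mulr_ge0 (ltW n0) p0)).
by lra.
Qed.

(** With parameter [l = ln (1 + delta)] the chord bound reads [1 + delta * Y], and
    [l * (1 + delta) >= delta] cancels the mean. Only the slack [u] is left in the exponent, so no
    lower bound on the mean is needed. *)
Lemma prob_sum_upper (Y : 'I_n -> R) (delta u : R) :
  (forall x, 0 <= Y x <= 1) -> 0 <= delta -> 0 <= u ->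
  prob [set s : {ffun 'I_m -> 'I_n} |
         (1 + delta) * (m%:R * (\sum_x Y x) / n%:R + u) < \sum_i Y (s i)] <=
  expR (- (delta * u)).
Proof.
move=> Y01 d0 u0; rewrite -[m%:R * _ / _]mulrA; set nu := (\sum_x Y x) / n%:R.
have n0 : 0 < n%:R :> R by rewrite ltr0n.
have nu0 : 0 <= nu by rewrite divr_ge0 ?ler0n// sumr_ge0// => x _; have /andP[] := Y01 x.
have d1 : 0 < 1 + delta by rewrite ltr_wpDr.
set l := ln (1 + delta).
have el : expR l = 1 + delta by rewrite lnK// posrE.
have l0 : 0 <= l by rewrite ln_ge0// lerDl.
have ld : delta <= l * (1 + delta).
  have := expR_ge1Dx (- l); rewrite expRN el -(ler_pM2r d1) mulVf ?gt_eqF//.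
  by lra.
apply: le_trans (_ : _ <= prob [set s : {ffun 'I_m -> 'I_n} |
    l * ((1 + delta) * (m%:R * nu + u)) <= \sum_i l * Y (s i)]) _.
  apply: prob_le; apply/subsetP => s; rewrite !inE -mulr_sumr => hs.
  by rewrite ler_wpM2l// ltW.
apply: le_trans (chernoff_tail (fun x => l * Y x) (delta * nu) _ n_gt0 _) _; last first.
  rewrite ler_expR.
  have : delta * (m%:R * nu + u) <= l * (1 + delta) * (m%:R * nu + u).
    by rewrite ler_wpM2r// addr_ge0// mulr_ge0.
  by lra.
apply: le_trans (_ : _ <= \sum_x (1 + delta * Y x)) _.
  apply: ler_sum => x _; apply: le_trans (expR_chord _ _ (Y01 x)) _.
  by rewrite el; lra.
rewrite big_split /= sumr_const card_ord -mulr_sumr.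
have -> : \sum_x Y x = n%:R * nu by rewrite /nu mulrCA divff ?mulr1// gt_eqF.
apply: le_trans (ler_wpM2l (ltW n0) (expR_ge1Dx _)).
by lra.
Qed.

End SampleTails.

(** * Squared distances and clusters *)

Section Geometry.
Context {R : realType} {D : nat}.
Notation pt := 'rV[R]_D.
Implicit Types p q r y : pt.

Lemma sqdist_ge0 p q : 0 <= sqdist p q.
Proof. by apply: sumr_ge0 => i _; exact: sqr_ge0. Qed.

Lemma sqdistC p q : sqdist p q = sqdist q p.
Proof. by apply: eq_bigr => i _; rewrite -sqrrN opprB. Qed.

Lemma sqdistxx p : sqdist p p = 0.
Proof. by apply: big1 => i _; rewrite subrr expr0n. Qed.

Lemma sqdist_triangle p q r : sqdist p r <= 2 * sqdist p q + 2 * sqdist q r.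
Proof.
rewrite /sqdist !mulr_sumr -big_split /=; apply: ler_sum => i _.
have := sqr_ge0 ((p ord0 i - q ord0 i) - (q ord0 i - r ord0 i)).
by lra.
Qed.

Lemma dist2_le K p (H : 'I_K -> pt) i : dist2 p H <= sqdist p (H i).
Proof. exact: bigmin_le. Qed.

Lemma dist2_attained K p (H : 'I_K -> pt) : (0 < K)%N ->
  exists i, dist2 p H = sqdist p (H i).
Proof.
case: K H => // K H _; rewrite /dist2.
elim/big_ind: _ => [|x y [i ->] [j ->]|i _]; last by exists i.
  by rewrite enum_ordSl /=; exists ord0.
by rewrite /Num.min; case: ifP => _; [exists i|exists j].
Qed.

Lemma dist2_ge0 K p (H : 'I_K -> pt) : (0 < K)%N -> 0 <= dist2 p H.
Proof. by move=> /(dist2_attained K p H)[i ->]; exact: sqdist_ge0. Qed.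

Lemma dist2_triangle K p q (H : 'I_K -> pt) : (0 < K)%N ->
  dist2 p H <= 2 * sqdist p q + 2 * dist2 q H.
Proof.
move=> /(dist2_attained K q H)[i ->].
exact: le_trans (dist2_le _ _ _ _) (sqdist_triangle _ _ _).
Qed.

(** Parallel axis identity: the cross term vanishes because deviations from the mean sum to zero. *)
Lemma sum_sqdist_mean n (P : 'I_n -> pt) (C : {set 'I_n}) y : (0 < #|C|)%N ->
  \sum_(i in C) sqdist (P i) y =
  \sum_(i in C) sqdist (P i) (mean_pt P C) + #|C|%:R * sqdist (mean_pt P C) y.
Proof.
move=> C0; have C0R : #|C|%:R != 0 :> R by rewrite pnatr_eq0 -lt0n.
rewrite /sqdist exchange_big [X in _ = X + _]exchange_big mulr_sumr -big_split /=.
apply: eq_bigr => t _; set mu := mean_pt P C ord0 t.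
have sum0 : \sum_(i in C) (P i ord0 t - mu) = 0.
  rewrite sumrB sumr_const -[mu *+ _]mulr_natl /mu mxE mulrA divff// mul1r.
  by rewrite summxE subrr.
rewrite (eq_bigr (fun i => (P i ord0 t - mu) ^+ 2 +
    (2 * (mu - y ord0 t) * (P i ord0 t - mu) + (mu - y ord0 t) ^+ 2))) => [|i _]; last by ring.
by rewrite !big_split /= -mulr_sumr sum0 mulr0 add0r sumr_const [in RHS]mulr_natl.
Qed.

Lemma mean_pt_min n (P : 'I_n -> pt) (C : {set 'I_n}) y :
  \sum_(i in C) sqdist (P i) (mean_pt P C) <= \sum_(i in C) sqdist (P i) y.
Proof.
have [C0|C0] := posnP #|C|.
  by rewrite (cards0_eq C0) !big_set0.
by rewrite (sum_sqdist_mean _ _ _ y)// lerDl mulr_ge0 ?ler0n ?sqdist_ge0.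
Qed.

Lemma sqdist_mean_le n (P : 'I_n -> pt) (C : {set 'I_n}) y (b : R) : (0 < #|C|)%N ->
  (forall i, i \in C -> sqdist (P i) y <= b) -> sqdist (mean_pt P C) y <= b.
Proof.
move=> C0 Cb; have C0R : 0 < #|C|%:R :> R by rewrite ltr0n.
rewrite -(ler_pM2l C0R); apply: le_trans (_ : _ <= \sum_(i in C) sqdist (P i) y) _.
  by rewrite (sum_sqdist_mean _ _ _ y)// lerDr sumr_ge0// => i _; exact: sqdist_ge0.
by apply: le_trans (ler_sum _ Cb) _; rewrite sumr_const mulr_natl.
Qed.

Section Clusters.
Context {n k : nat} (P : 'I_n -> pt) (Popt : {set 'I_n}) (a : 'I_n -> 'I_k).
Local Notation C := (cluster Popt a).

Lemma sum_cluster (F : 'I_n -> R) :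
  \sum_(i in Popt) F i = \sum_j \sum_(i in C j) F i.
Proof.
rewrite (partition_big a predT)//=; apply: eq_bigr => j _.
by apply: eq_bigl => i; rewrite inE.
Qed.

Lemma sum_sample_cluster m (s : {ffun 'I_m -> 'I_n}) (F : 'I_m -> R) :
  \sum_(i | s i \in Popt) F i = \sum_j \sum_(i | s i \in C j) F i.
Proof.
rewrite (partition_big (fun i => a (s i)) predT)//=; apply: eq_bigr => j _.
by apply: eq_bigl => i; rewrite inE.
Qed.

Lemma sqdist_le_diamL j i i' : i \in C j -> i' \in C j ->
  sqdist (P i) (P i') <= diamL P C ^+ 2.
Proof.
move=> iC i'C; have -> : sqdist (P i) (P i') = edist (P i) (P i') ^+ 2.
  by rewrite sqr_sqrtr ?sqdist_ge0.
have e0 : 0 <= edist (P i) (P i') by exact: sqrtr_ge0.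
have el : edist (P i) (P i') <= diamL P C.
  apply: (bigmax_sup j) => //; apply: (bigmax_sup i) => //.
  exact: (bigmax_sup i').
by rewrite lerXn2r ?nnegrE// (le_trans e0).
Qed.

Lemma sqdist_mean_le_diamL i : i \in Popt ->
  sqdist (P i) (mean_pt P (C (a i))) <= diamL P C ^+ 2.
Proof.
move=> iP; have iC : i \in C (a i) by rewrite inE iP eqxx.
rewrite sqdistC; apply: sqdist_mean_le => [|i' i'C].
  by apply/card_gt0P; exists i.
exact: (@sqdist_le_diamL (a i)).
Qed.

(* Each inlier reaches [H] through its center, and the distance from a center
   to [H] is averaged over the samples of its cluster. *)
Lemma inlier_cost_le m (s : {ffun 'I_m -> 'I_n}) (O : 'I_k -> pt) K (H : 'I_K -> pt)
    (r : R) : (0 < K)%N -> 0 <= r ->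
  (forall j, #|C j|%:R <= r * (hits (C j) s)%:R) ->
  \sum_(i in Popt) dist2 (P i) H <=
  2 * \sum_(i in Popt) sqdist (P i) (O (a i)) +
  4 * r * (\sum_(i | s i \in Popt) sqdist (P (s i)) (O (a (s i))) +
           \sum_i dist2 (P (s i)) H).
Proof.
move=> K0 r0 rC.
have d0 p : 0 <= dist2 p H by exact: dist2_ge0.
apply: le_trans (_ : _ <= 2 * \sum_(i in Popt) sqdist (P i) (O (a i)) +
  4 * r * (\sum_(i | s i \in Popt) (sqdist (P (s i)) (O (a (s i))) + dist2 (P (s i)) H))) _; last first.
  rewrite lerD2l ler_wpM2l ?mulr_ge0// big_split lerD2l /=.
  by rewrite [leRHS](bigID (fun i => s i \in Popt)) /= lerDl sumr_ge0.
rewrite sum_sample_cluster !sum_cluster !mulr_sumr -big_split /=.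
apply: ler_sum => j _.
have aC i : i \in C j -> a i = j by rewrite inE => /andP[_ /eqP].
(* [d] is eliminated between the next two bounds: [2 |C j| d <= 2 r hits d], and the samples bound
   [hits d] with another factor 2, whence [4 r]. *)
set d := dist2 (O j) H.
have inliers : \sum_(i in C j) dist2 (P i) H <=
    2 * \sum_(i in C j) sqdist (P i) (O (a i)) + 2 * (#|C j|%:R * d).
  rewrite mulr_sumr mulrCA mulr_natl -sumr_const -big_split /=.
  by apply: ler_sum => i iC; rewrite aC//; exact: dist2_triangle.
have samples : (hits (C j) s)%:R * d <=
    2 * \sum_(i | s i \in C j) (sqdist (P (s i)) (O (a (s i))) + dist2 (P (s i)) H).
  rewrite /hits mulr_natl -sumr_const mulr_sumr big_mkcond [leRHS]big_mkcond /=.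
  apply: ler_sum => i _; rewrite inE; case: ifPn => // iC.
  by rewrite aC// mulrDr sqdistC; exact: dist2_triangle.
have := ler_wpM2l r0 samples; have := ler_wpM2r (d0 (O j)) (rC j); rewrite -/d.
by lra.
Qed.

(** The centers are [O] followed by the sampled outliers themselves, which then cost nothing; spare
    slots hold the origin. *)
Lemma sample_cost_le m kp (s : {ffun 'I_m -> 'I_n}) (O : 'I_k -> pt) :
  (hits (~: Popt) s <= kp)%N ->
  exists H : 'I_(k + kp) -> pt, \sum_i dist2 (P (s i)) H <=
    \sum_(i | s i \in Popt) sqdist (P (s i)) (O (a (s i))).
Proof.
move=> hs; pose outs := [seq P (s i) | i <- enum [set i | s i \in ~: Popt]].
have souts : size outs = hits (~: Popt) s by rewrite size_map -cardE.
exists (fun i => match split i with inl j => O j | inr l => nth 0 outs l end).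
rewrite [leRHS]big_mkcond /=; apply: ler_sum => i _; case: ifPn => iP.
  apply: le_trans (dist2_le _ _ _ (lshift kp (a (s i)))) _.
  by rewrite (unsplitK (inl _)).
have io : P (s i) \in outs by apply: map_f; rewrite mem_enum !inE.
have il : (index (P (s i)) outs < kp)%N by apply: leq_trans hs; rewrite -souts index_mem.
apply: le_trans (dist2_le _ _ _ (rshift k (Ordinal il))) _.
by rewrite (unsplitK (inr _)) /= nth_index// sqdistxx.
Qed.

End Clusters.
End Geometry.

(** * Deterministic bound for a good sample *)

(** Moving each center of [O0] to its cluster mean does not raise the cost on [Popt], and by
    optimality the trimmed cost of [O0] is at most that of the means, even if these prefer other
    inliers. *)
Lemma optimal_cost_le {R : realType} {D n k z : nat} (P : 'I_n -> 'rV[R]_D)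
    (O0 : 'I_k -> 'rV[R]_D) (Popt : {set 'I_n}) (a : 'I_n -> 'I_k) : (z < n)%N ->
  optimal_solution z P O0 Popt a ->
  \sum_(i in Popt) sqdist (P i) (mean_pt P (cluster Popt a (a i))) <=
  (n - z)%:R * trimmed_cost P z (fun j => mean_pt P (cluster Popt a j)).
Proof.
move=> zn [O0opt cPopt O0cost a0].
have nz0 : 0 < (n - z)%:R :> R by rewrite ltr0n subn_gt0.
apply: le_trans (_ : _ <= (n - z)%:R * trimmed_cost P z O0) _; last first.
  by rewrite ler_wpM2l ?O0opt// ltW.
rewrite -O0cost /avg_cost cPopt mulrCA divff ?gt_eqF// mulr1.
rewrite -(eq_bigr _ a0) !(sum_cluster _ a); apply: ler_sum => j _.
have aC i : i \in cluster Popt a j -> a i = j by rewrite inE => /andP[_ /eqP].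
rewrite (eq_bigr (fun i => sqdist (P i) (mean_pt P (cluster Popt a j)))) => [|i /aC -> //].
rewrite [leRHS](eq_bigr (fun i => sqdist (P i) (O0 j))) => [|i /aC -> //].
exact: mean_pt_min.
Qed.

Section GoodSample.
Context {R : realType} {D n k m : nat} (P : 'I_n -> 'rV[R]_D).
Context (Popt : {set 'I_n}) (a : 'I_n -> 'I_k) (O : 'I_k -> 'rV[R]_D).
Context (s : {ffun 'I_m -> 'I_n}) (delta c e : R).
Hypotheses (m_gt0 : (0 < m)%N) (Popt_gt0 : (0 < #|Popt|)%N).
Hypotheses (delta01 : 0 < delta < 1) (c_ge1 : 1 <= c).
Local Notation C := (cluster Popt a).
Local Notation cost := (\sum_(i in Popt) sqdist (P i) (O (a i))).
Local Notation sample_cost := (\sum_(i | s i \in Popt) sqdist (P (s i)) (O (a (s i)))).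

Lemma good_sample_avg_cost K (H : 'I_K -> 'rV[R]_D) (beta : R) : (0 < K)%N ->
  beta = (4 + 4 * c) * ((1 + delta) / (1 - delta)) ->
  (forall j, (1 - delta) * (m%:R * #|C j|%:R / n%:R) <= (hits (C j) s)%:R) ->
  sample_cost <= (1 + delta) * (m%:R / n%:R * (cost + #|Popt|%:R * e)) ->
  \sum_i dist2 (P (s i)) H <= c * sample_cost ->
  avg_cost P Popt H <= (2 + beta) * (cost / #|Popt|%:R) + beta * e.
Proof.
move=> K0 betaE hC hcost hH; have /andP[d0 d1] := delta01.
have n0 : (0 < n)%N by apply: leq_trans Popt_gt0 _; rewrite -[leqRHS]card_ord max_card.
have n0R : 0 < n%:R :> R by rewrite ltr0n.
have m0R : 0 < m%:R :> R by rewrite ltr0n.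
have Popt0R : 0 < #|Popt|%:R :> R by rewrite ltr0n.
have d1' : 0 < 1 - delta by rewrite subr_gt0.
(* Inverse of the sampling rate guaranteed in every cluster; [4 r (1 + c) (1 + delta) m / n] is then
   exactly [beta]. *)
pose r : R := n%:R / (m%:R * (1 - delta)).
have r0 : 0 < r by rewrite divr_gt0 ?mulr_gt0.
have rC j : #|C j|%:R <= r * (hits (C j) s)%:R.
  apply: le_trans (ler_wpM2l (ltW r0) (hC j)).
  rewrite le_eqVlt; apply/orP; left; apply/eqP; rewrite /r; field.
  by rewrite !gt_eqF.
have inl := inlier_cost_le P Popt a m s O K H r K0 (ltW r0) rC.
rewrite /avg_cost ler_pdivrMr//.
rewrite [leRHS](_ : _ = 2 * cost + beta * (cost + #|Popt|%:R * e)); last first.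
  by field; rewrite gt_eqF.
apply: le_trans inl _; rewrite lerD2l.
have rE : beta * (cost + #|Popt|%:R * e) =
    4 * r * ((1 + c) * ((1 + delta) * (m%:R / n%:R * (cost + #|Popt|%:R * e)))).
  by rewrite betaE /r; field; rewrite !gt_eqF.
rewrite rE ler_wpM2l ?(mulr_ge0 (ler0n _ 4) (ltW r0))//.
apply: le_trans (_ : _ <= (1 + c) * sample_cost) _.
  by rewrite mulrDl mul1r lerD2l.
by rewrite ler_wpM2l// addr_ge0// (le_trans ler01).
Qed.

End GoodSample.

(** * Probability of failure *)

(** Up to [eta = 1/2] the bound [u <= eta] suffices; beyond it, [u <= 1/2] leaves [(1 - eta) / 2],
    and [(1 - eta)^2 <= 1/2]. *)
Lemma union_failure_le {R : realType} (eta u v : R) : 0 < eta < 1 ->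
  u <= eta -> u <= 1 / 2 -> v <= eta / 2 -> (1 - eta) ^+ 3 <= 1 - (u + v).
Proof.
move=> /andP[e0 e1] ue u2 v2; have [el|eg] := leP eta (1 / 2).
  have : 0 <= eta * (1 / 2 - eta) by rewrite mulr_ge0 ?subr_ge0// ltW.
  have : 0 <= eta ^+ 3 by rewrite exprn_ge0// ltW.
  by lra.
have : 0 <= (1 - eta) * (1 / 2 - (1 - eta) ^+ 2) by rewrite mulr_ge0//; nra.
by lra.
Qed.

Section FailureProbability.
Context {R : realType} {n k m kp : nat} (Popt : {set 'I_n}) (a : 'I_n -> 'I_k).
Context (eta delta lam : R).
Local Notation C := (cluster Popt a).

Definition few_hits (j : 'I_k) : {set {ffun 'I_m -> 'I_n}} :=
  [set s | (hits (C j) s)%:R < (1 - delta) * (m%:R * #|C j|%:R / n%:R)].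

Definition many_outliers : {set {ffun 'I_m -> 'I_n}} :=
  [set s | (kp < hits (~: Popt) s)%N].

Hypotheses (k_gt0 : (0 < k)%N) (n_gt0 : (0 < n)%N).
Hypotheses (Popt_gt0 : (0 < #|Popt|)%N) (out_gt0 : (0 < #|~: Popt|)%N).
Hypotheses (eta01 : 0 < eta < 1) (delta_ge0 : 0 <= delta).
Hypothesis lamE : expR (- lam) = eta / (2 * k%:R).
Hypothesis outliers : m%:R * #|~: Popt|%:R <= eta * kp%:R * n%:R :> R.
Hypothesis cluster_size : forall j, 3 * lam <= delta ^+ 2 * (m%:R * #|C j|%:R / n%:R).

Lemma lam_ge0 : 0 <= lam.
Proof.
have /andP[e0 e1] := eta01.
rewrite -oppr_le0 -expR_le1 lamE ler_pdivrMr ?mul1r ?mulr_gt0 ?ltr0n//.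
by have : 1 <= k%:R :> R by [rewrite ler1n]; lra.
Qed.

Lemma prob_few_hits j : prob (few_hits j) <= expR (- (3 / 2 * lam)).
Proof.
apply: le_trans (prob_hits_lower n_gt0 _ _ delta_ge0) _.
by rewrite ler_expR lerN2; have := cluster_size j; lra.
Qed.

(** The expected number of sampled outliers is at most [eta * kp], which gives Markov's bound, hence
    at most [kp], which gives the median bound. *)
Lemma prob_many_outliers : prob many_outliers <= eta /\ prob many_outliers <= 1 / 2 :> R.
Proof.
have /andP[e0 e1] := eta01; split; first exact: prob_hits_markov (ltW e0) outliers.
apply: prob_hits_median => //; first by rewrite setCK.
rewrite -(ler_nat R) !natrM; apply: le_trans outliers _.
by rewrite -mulrA ler_piMl ?mulr_ge0 ?ler0n// ltW.
Qed.

(* For a single cluster both failures are upper tails of the number of sampled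
   outliers, so one contains the other and no union bound is needed. *)
Lemma single_cluster_nested j : k = 1%N ->
  few_hits j \subset many_outliers \/ many_outliers \subset few_hits j.
Proof.
move=> k1; have CE : C j = Popt.
  apply/setP => i; rewrite inE; case: (i \in Popt) => //=.
  by move: (a i) j; rewrite k1 => x y; rewrite !ord1 eqxx.
have hE (s : {ffun 'I_m -> 'I_n}) : (hits Popt s + hits (~: Popt) s = m)%N.
  rewrite /hits -[RHS](card_ord m) -(cardsC [set i | s i \in Popt]); congr (_ + _)%N.
  by apply: eq_card => i; rewrite !inE.
have hR (s : {ffun 'I_m -> 'I_n}) : (hits Popt s)%:R + (hits (~: Popt) s)%:R = m%:R :> R.
  by rewrite -natrD hE.
set t : R := (1 - delta) * (m%:R * #|Popt|%:R / n%:R).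
(* More than [kp] outliers means at most [m - kp - 1] sampled inliers, so comparing this number with
   [t] decides which event is smaller. *)
have [tl|tg] := leP t (m%:R - kp%:R - 1); [left|right];
  apply/subsetP => s; rewrite !inE CE -/t -(ler_nat R) -natr1;
  have := hR s; lra.
Qed.

(** The term [expR (- (k * lam))] is reserved for the failure of the sampled cost. For [k = 1] it
    uses up all of [eta / 2], so [v = 0] and nesting is essential; for [k >= 2] it is at most
    [(eta / 4)^2], and [v = eta / 4] fits. *)
Lemma prob_hits_failure : exists u v : R, [/\ u <= eta, u <= 1 / 2,
  prob (many_outliers :|: \bigcup_j few_hits j) <= u + v &
  v + expR (- (k%:R * lam)) <= eta / 2].
Proof.
have /andP[e0 e1] := eta01; have [oe o2] := prob_many_outliers.
have l0 := lam_ge0.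
have [k1|k2] : k = 1%N \/ (1 < k)%N by lia.
  have j0 : 'I_k by rewrite k1; exact: ord0.
  have fj0 : \bigcup_j few_hits j = few_hits j0.
    apply/setP => s; apply/bigcupP/idP => [[j _]|sj]; last by exists j0.
    by have -> : j = j0 by move: j j0; rewrite k1 => x y; rewrite !ord1.
  exists (prob (many_outliers :|: \bigcup_j few_hits j)), 0.
  have fe : prob (few_hits j0) <= eta / 2.
    apply: le_trans (prob_few_hits j0) _.
    apply: le_trans (_ : _ <= expR (- lam)) _; first by rewrite ler_expR; lra.
    by rewrite lamE k1; lra.
  have ke : expR (- (k%:R * lam)) = eta / 2 by rewrite k1 mul1r lamE k1 mulr1.
  rewrite ke fj0 addr0 add0r !lexx.
  have [/setUidPl ->|/setUidPr ->] := single_cluster_nested j0 k1; split=> //; lra.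
have k2R : 2 <= k%:R :> R by rewrite ler_nat.
have kR0 : 0 < k%:R :> R by lra.
have kl : k%:R * expR (- lam) = eta / 2.
  by rewrite lamE; field; rewrite gt_eqF.
have l4 : expR (- lam) <= eta / 4.
  by rewrite lamE ler_pM2l// lef_pV2 ?posrE; lra.
(* The surplus [lam / 2] in the exponent of [prob_few_hits] halves the union bound
   [k * expR (- lam) = eta / 2]. *)
have lh : expR (- (lam / 2)) <= 1 / 2.
  have sq : expR (- (lam / 2)) ^+ 2 <= (1 / 2) ^+ 2.
    by rewrite -expRM_natl (_ : 2 * _ = - lam); [lra|field].
  by rewrite -(ler_pXn2r (_ : 0 < 2)%N) ?nnegrE ?expR_ge0//; lra.
exists (prob many_outliers), (eta / 4); split=> //.
  apply: le_trans (probU _ _) _; rewrite lerD2l.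
  apply: le_trans (prob_bigcup _ _) _.
  apply: le_trans (ler_sum _ (fun j _ => prob_few_hits j)) _.
  rewrite sumr_const card_ord -[_ *+ k]mulr_natl.
  rewrite (_ : - (3 / 2 * lam) = - lam + - (lam / 2)); last by field.
  rewrite expRD mulrA kl; have := ler_wpM2l (_ : 0 <= eta / 2) lh.
  by move=> /(_ (divr_ge0 (ltW e0) (ler0n _ 2))); lra.
have : expR (- (k%:R * lam)) <= expR (- lam) ^+ 2.
  by rewrite -expRM_natl ler_expR mulrN lerN2 ler_wpM2r.
have : expR (- lam) ^+ 2 <= (eta / 4) ^+ 2.
  by rewrite lerXn2r ?nnegrE ?expR_ge0//; lra.
have : 0 <= eta * (1 - eta) by rewrite mulr_ge0 ?subr_ge0// ltW.
by lra.
Qed.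

End FailureProbability.

Theorem theorem3 (R : realType) (D n k z : nat) (P : 'I_n -> 'rV[R]_D)
    (eps1 eps2 eta delta xi c : R)
    (O0 : 'I_k -> 'rV[R]_D) (Popt : {set 'I_n}) (a : 'I_n -> 'I_k)
    (m kp : nat)
    (Alg : {ffun 'I_m -> 'I_n} -> 'I_(k + kp) -> 'rV[R]_D) :
  injective P -> (0 < k)%N -> (0 < z)%N -> (z < n)%N ->
  optimal_solution z P O0 Popt a ->
  significant z (cluster Popt a) eps1 eps2 ->
  0 < eta < 1 -> 0 < delta < 1 -> 0 < xi < 1 -> 1 <= c ->
  (* |S| = sample size, rounded up to an integer *)
  (m : int) = Num.ceil (Num.max
      (3 * k%:R / (delta ^+ 2 * eps1) * ln (2 * k%:R / eta))
      (k%:R / (2 * xi ^+ 2 * eps1 * (1 - delta)) * ln (2 * k%:R / eta))) ->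
  (* k' = (1/eta) (eps2/k) |S|, rounded up to an integer *)
  (kp : int) = Num.ceil (eta^-1 * (eps2 / k%:R) * m%:R) ->
  (* Alg is a c-approximation for (k+k')-means on the sampled multiset S *)
  (forall (s : {ffun 'I_m -> 'I_n}) (H : 'I_(k + kp) -> 'rV[R]_D),
      \sum_(i < m) dist2 (P (s i)) (Alg s) <= c * \sum_(i < m) dist2 (P (s i)) H) ->
  let Ostar := fun j => mean_pt P (cluster Popt a j) in
  let L := diamL P (cluster Popt a) in
  let beta := (4 + 4 * c) * ((1 + delta) / (1 - delta)) in
  let alpha := 2 + beta in
  (1 - eta) ^+ 3 <=
    #|[set s : {ffun 'I_m -> 'I_n} |
        trimmed_cost P z (Alg s) <= alpha * trimmed_cost P z Ostar + beta * xi * L ^+ 2]|%:R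
    / (n ^ m)%:R.
Proof.
move=> _ k0 z0 zn opt [e1 e2 Csize zE] eta01 delta01 xi01 c1 mE kpE Algc.
cbv zeta; set beta := (4 + 4 * c) * _; set alpha := 2 + beta.
set Ostar := fun j => mean_pt P (cluster Popt a j).
set L := diamL P (cluster Popt a).
have /andP[eta0 eta1] := eta01; have /andP[d0 d1] := delta01; have /andP[xi0 xi1] := xi01.
have [_ cPopt _ _] := opt.
have n0 : (0 < n)%N by exact: leq_trans zn.
have n0R : 0 < n%:R :> R by rewrite ltr0n.
have k0R : 0 < k%:R :> R by rewrite ltr0n.
have k1R : 1 <= k%:R :> R by rewrite ler1n.
have Popt0 : (0 < #|Popt|)%N by rewrite cPopt subn_gt0.
have Popt0R : 0 < #|Popt|%:R :> R by rewrite ltr0n.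
have coutE : #|~: Popt| = z.
  by apply/eqP; rewrite -(eqn_add2l #|Popt|) cardsC card_ord cPopt subnK// ltnW.
set C := cluster Popt a in Csize Ostar L *.
pose lam : R := ln (2 * k%:R / eta).
have lam1 : 1 < 2 * k%:R / eta by rewrite ltr_pdivlMr// mul1r; lra.
have lam0 : 0 < lam by rewrite ln_gt0.
have lamE : expR (- lam) = eta / (2 * k%:R).
  by rewrite expRN lnK ?posrE ?(lt_trans ltr01)// invf_div.
have [m1 m2] : 3 * k%:R / (delta ^+ 2 * eps1) * lam <= m%:R /\
    k%:R / (2 * xi ^+ 2 * eps1 * (1 - delta)) * lam <= m%:R.
  apply/andP; rewrite -ge_max; have := ceil_ge (Num.max
    (3 * k%:R / (delta ^+ 2 * eps1) * lam)
    (k%:R / (2 * xi ^+ 2 * eps1 * (1 - delta)) * lam)).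
  by rewrite -mE.
have m0R : 0 < m%:R :> R.
  by apply: lt_le_trans m1; rewrite mulr_gt0// divr_gt0 ?mulr_gt0// exprn_gt0.
have m0 : (0 < m)%N by rewrite -(ltr0n R).
have kpm : eta^-1 * (eps2 / k%:R) * m%:R <= kp%:R.
  by have := ceil_ge (eta^-1 * (eps2 / k%:R) * m%:R); rewrite -kpE.
have m1' : 3 * (k%:R * lam) <= m%:R * eps1 * delta ^+ 2.
  move: m1; rewrite mulrAC ler_pdivrMr ?mulr_gt0 ?exprn_gt0//; lra.
have m2' : k%:R * lam / 2 <= m%:R * eps1 * xi ^+ 2.
  move: m2; rewrite mulrAC ler_pdivrMr ?mulr_gt0 ?exprn_gt0 ?subr_gt0// => m2.
  have : 0 <= m%:R * eps1 * xi ^+ 2 * delta by rewrite !mulr_ge0 ?sqr_ge0// ltW.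
  by lra.
have PoptE : \sum_j #|C j|%:R = #|Popt|%:R :> R.
  have := sum_cluster Popt a (fun=> 1 : R); rewrite sumr_const => ->.
  by apply: eq_bigr => j _; rewrite sumr_const.
have p1 : eps1 * n%:R <= #|Popt|%:R.
  rewrite -PoptE; apply: le_trans (ler_sum _ (fun j _ => Csize j)).
  rewrite sumr_const card_ord -[_ *+ k]mulr_natr le_eqVlt; apply/orP; left.
  by apply/eqP; field; rewrite gt_eqF.
have CR j : 3 * lam <= delta ^+ 2 * (m%:R * #|C j|%:R / n%:R).
  rewrite !mulrA ler_pdivlMr//.
  have := ler_wpM2l (mulr_ge0 (sqr_ge0 delta) (ltW m0R)) (Csize j).
  apply: le_trans.
  rewrite [leRHS](_ : _ = (m%:R * eps1 * delta ^+ 2) / k%:R * n%:R); last by field; rewrite gt_eqF.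
  by rewrite ler_pM2r// ler_pdivlMr//; lra.
(* As [z = eps2 n / k], this is the definition of [kp] with its rounding up. *)
have outs : m%:R * #|~: Popt|%:R <= eta * kp%:R * n%:R :> R.
  have := ler_wpM2l (ltW eta0) kpm => /(ler_wpM2r (ltW n0R)); apply: le_trans.
  rewrite coutE zE le_eqVlt; apply/orP; left; apply/eqP.
  by field; rewrite !gt_eqF.
have out0 : (0 < #|~: Popt|)%N by rewrite coutE.
have L0 : 0 <= L ^+ 2 by exact: sqr_ge0.
(* Scaled into [[0, 1]] for the Chernoff bound. If [L = 0] the quotient is 0, and so are the
   distances, so [YL] still holds. *)
pose Y (x : 'I_n) : R := if x \in Popt then sqdist (P x) (Ostar (a x)) / L ^+ 2 else 0.
have Y01 x : 0 <= Y x <= 1.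
  rewrite /Y; case: ifPn => [xP|_]; last by rewrite lexx ler01.
  rewrite divr_ge0 ?sqdist_ge0//=.
  have [L2|L2] := eqVneq (L ^+ 2) 0; first by rewrite L2 invr0 mulr0 ler01.
  rewrite ler_pdivrMr ?mul1r; last by rewrite lt0r L2.
  exact: sqdist_mean_le_diamL.
have YL x : x \in Popt -> sqdist (P x) (Ostar (a x)) = Y x * L ^+ 2.
  move=> xP; rewrite /Y xP.
  have [L2|L2] := eqVneq (L ^+ 2) 0; last by rewrite divfK.
  rewrite L2 mulr0; apply/eqP; rewrite eq_le sqdist_ge0 andbT -L2.
  exact: sqdist_mean_le_diamL.
(* After scaling back by [L^2], this slack becomes the [xi * L^2] per inlier of the final bound. *)
pose u : R := m%:R * (xi * #|Popt|%:R) / n%:R.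
have u0 : 0 <= u by rewrite divr_ge0 ?mulr_ge0// ltW.
have du : k%:R * lam <= delta * u.
  have step : m%:R * eps1 * (delta * xi) <= delta * u.
    rewrite /u [leRHS](_ : _ = m%:R * (delta * xi) * (#|Popt|%:R / n%:R));
      last by field; rewrite gt_eqF.
    have mdx0 : 0 <= m%:R * (delta * xi) by rewrite !mulr_ge0 ?ltW.
    by rewrite mulrAC ler_wpM2l// ler_pdivlMr.
  apply: le_trans step.
  have kl0 : 0 < k%:R * lam by rewrite mulr_gt0.
  have mdx0 : 0 <= m%:R * eps1 * (delta * xi) by rewrite !mulr_ge0 ?ltW.
  (* Multiplying [m1'] by [m2'] gives [3/2 (k lam)^2 <= (m eps1 delta xi)^2]. *)
  rewrite -(ler_pXn2r (_ : 0 < 2)%N) ?nnegrE ?(ltW kl0)//.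
  have k3 : 0 <= 3 * (k%:R * lam) by lra.
  have k2 : 0 <= k%:R * lam / 2 by lra.
  have := ler_pM k3 k2 m1' m2'; have := sqr_ge0 (k%:R * lam).
  by lra.
pose bad_cost := [set s : {ffun 'I_m -> 'I_n} |
  (1 + delta) * (m%:R * (\sum_x Y x) / n%:R + u) < \sum_i Y (s i)].
have bad_costP : prob bad_cost <= expR (- (k%:R * lam)).
  apply: le_trans (prob_sum_upper n0 Y delta u Y01 (ltW d0) u0) _.
  by rewrite ler_expR lerN2.
have [pu [pv [pue pu2 puv pve]]] := prob_hits_failure Popt a eta delta lam k0 n0
  Popt0 out0 eta01 (ltW d0) lamE outs CR.
set bad := _ :|: _ in puv.
have badC : 1 - (pu + (pv + expR (- (k%:R * lam)))) <= prob (~: (bad :|: bad_cost)).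
  rewrite probC// lerD2l lerN2 addrA.
  by apply: le_trans (probU _ _) _; rewrite lerD.
apply: le_trans (union_failure_le eta _ _ eta01 pue pu2 pve) _.
apply: le_trans badC _; rewrite -[X in _ <= X]/(prob _); apply: prob_le.
apply/subsetP => s; rewrite in_setC !in_setU !negb_or => /andP[/andP[sout shits] scost].
rewrite inE.
have sumYS : \sum_(i | s i \in Popt) sqdist (P (s i)) (Ostar (a (s i))) =
    (\sum_i Y (s i)) * L ^+ 2.
  rewrite (eq_bigr (fun i => Y (s i) * L ^+ 2)) => [|i /YL//].
  rewrite -mulr_suml; congr (_ * _); rewrite big_mkcond; apply: eq_bigr => i _.
  by rewrite /Y; case: (_ \in Popt).
have sumY : \sum_(x in Popt) sqdist (P x) (Ostar (a x)) = (\sum_x Y x) * L ^+ 2.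
  rewrite (eq_bigr (fun x => Y x * L ^+ 2)) => [|x /YL//].
  rewrite -mulr_suml; congr (_ * _); rewrite big_mkcond; apply: eq_bigr => x _.
  by rewrite /Y; case: (_ \in Popt).
have kK0 : (0 < k + kp)%N by rewrite addn_gt0 k0.
(* [Popt] has [n - z] points, so it competes in the trimmed minimum. *)
apply: le_trans (_ : _ <= avg_cost P Popt (Alg s)) _.
  by apply: bigmin_le_cond; rewrite cPopt.
apply: le_trans (good_sample_avg_cost P Popt a Ostar s delta c (xi * L ^+ 2) m0 Popt0
  delta01 c1 _ (Alg s) beta kK0 erefl _ _ _) _.
- move=> j; rewrite leNgt; apply: contra shits => sj.
  by apply/bigcupP; exists j; rewrite // inE.
- rewrite sumYS sumY.
  move: scost; rewrite inE -leNgt => /(ler_wpM2r L0) /le_trans; apply.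
  rewrite le_eqVlt; apply/orP; left; apply/eqP; rewrite /u.
  by field; rewrite gt_eqF.
- have := sample_cost_le P Popt a m kp s Ostar; rewrite inE -leqNgt in sout.
  move=> /(_ sout)[H HS]; apply: le_trans (Algc s H) _.
  by rewrite ler_wpM2l// (le_trans ler01).
rewrite -/alpha [beta * (xi * _)]mulrA lerD2r ler_wpM2l//.
  rewrite /alpha /beta addr_ge0// mulr_ge0 ?divr_ge0//; lra.
rewrite ler_pdivrMr// mulrC cPopt; exact: optimal_cost_le opt.
Qed.
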